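(* Let $\theta^0_1,\theta^0_2,\theta^1,\theta^\infty_1,\theta^\infty_2,\theta^\infty_3\in\mathbb{C}$ with $\theta^0_1+\theta^0_2+\theta^1+\theta^\infty_1+\theta^\infty_2+\theta^\infty_3=0$, $\theta^0_1\neq0$, $\theta^1\neq0$, and $\theta^\infty_1,\theta^\infty_2,\theta^\infty_3$ pairwise distinct. Let $q_1,p_1,q_2,p_2,u,v$ be holomorphic functions of $t$ on a domain of $\mathbb{C}\setminus\{0\}$, with $q_1,q_2,u,v\neq0$. Put $$a=tq_1(p_1q_1-\theta^0_1-\theta^\infty_2)+p_1q_1(p_1q_1+p_2q_2+\theta^1),\quad b=tq_2(p_2q_2-\theta^\infty_3)+p_2q_2(p_1q_1+p_2q_2+\theta^1),$$ $$c=-q_2(p_2q_2-\theta^\infty_3)\left(\frac1{q_1}-\frac1{q_2}\right)+\theta^\infty_3,$$ $$\hat A_1^{(0)}=\begin{pmatrix}1\\-p_1q_1\\-p_2q_2\end{pmatrix}(p_1q_1+p_2q_2+\theta^1,\,1,\,1),\quad \hat A_0^{(-1)}=\begin{pmatrix}1\\0\\0\end{pmatrix}\left(t,\,-\frac1{q_1},\,-\frac1{q_2}\right),$$ $$\hat A_0^{(0)}=\begin{pmatrix}-p_1q_1-p_2q_2-\theta^1-\theta^\infty_1&-1&-1\\-tq_1(p_1q_1-\theta^0_1-\theta^\infty_2)&p_1q_1-\theta^\infty_2&p_1q_1\\-tq_2(p_2q_2-\theta^\infty_3)&q_2(p_2q_2-\theta^\infty_3)/q_1&p_2q_2-\theta^\infty_3\end{pmatrix},$$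 $$R=\begin{pmatrix}1&0&0\\\frac{a}{\theta^\infty_1-\theta^\infty_2}&1&0\\\frac1{\theta^\infty_1-\theta^\infty_3}\left(b+\frac{ac}{\theta^\infty_1-\theta^\infty_2}\right)&\frac{c}{\theta^\infty_2-\theta^\infty_3}&1\end{pmatrix},\qquad G=R\,\mathrm{diag}(1,u,v).$$ Consider the linear systems $$\frac{\partial Y}{\partial x}=AY,\quad A=G^{-1}\left(\frac{\hat A_0^{(-1)}}{x^2}+\frac{\hat A_0^{(0)}}{x}+\frac{\hat A_1^{(0)}}{x-1}\right)G,\qquad \frac{\partial Y}{\partial t}=BY,\quad B=-\frac1{tx}G^{-1}\hat A_0^{(-1)}G .$$ Then the compatibility condition $\partial_tA-\partial_xB+[A,B]=O$ (for all $x$) is equivalent to the Hamiltonian system $\frac{dq_i}{dt}=\frac{\partial H}{\partial p_i}$, $\frac{dp_i}{dt}=-\frac{\partial H}{\partial q_i}$ $(i=1,2)$ with $$tH=tH_{\mathrm V}\left({\theta^0_1+\theta^1+\theta^\infty_2+\theta^\infty_3,\ \theta^1+\theta^\infty_1-\theta^\infty_2-1\atop-\theta^1-\theta^\infty_3};t;q_1,p_1\right)+tH_{\mathrm V}\left({\theta^1+\theta^\infty_3,\ \theta^1+\theta^\infty_1-\theta^\infty_3-1\atop-\theta^1};t;q_2,p_2\right)$$ $$\qquad+p_1(q_2-1)\left\{p_2(q_1+q_2)-\theta^\infty_3\right\},$$ together with $$\frac{tq_1}{u}\frac{du}{dt}=q_2(p_2q_2-p_2-\theta^\infty_3)-q_1(2p_1+p_2+t)-\theta^1,\qquad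 \frac{tq_2}{v}\frac{dv}{dt}=-p_1(q_1+q_2)-(2p_2+t)q_2-\theta^1 .$$
   Context: $tH_{\mathrm V}\left({\alpha,\beta\atop\gamma};t;q,p\right)=p(p+t)q(q-1)+\beta pq+\gamma p-(\alpha+\gamma)tq$ defines the Hamiltonian $H_{\mathrm V}$ of the fifth Painlevé equation. The Hamiltonian $H$ is that of the degenerate Fuji–Suzuki system of type $A_4$; the linear system has an irregular singularity at $x=0$ and regular singularities at $x=1,\infty$, of spectral type $(11)(1),21,111$. *)

(* Defs.v *)
From HB Require Import structures.
From mathcomp Require Import all_boot all_order all_algebra.
From mathcomp Require Import complex.
From mathcomp Require Import boolp classical_sets reals topology normedtype derive.
Set Implicit Arguments.
Unset Strict Implicit.
Unset Printing Implicit Defensive.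
Import Order.TTheory GRing.Theory Num.Theory numFieldNormedType.Exports.
Local Open Scope classical_set_scope.
Local Open Scope ring_scope.

(* R[i] seen as an abstract numClosedFieldType: this is how it inherits the
   topology and the normed module structure (over itself) that MathComp-Analysis
   provides on every numFieldType, so that limits and derivatives below are the
   complex ones. *)
Definition Cplx (R : realType) : numClosedFieldType := R[i].

Section ComplexAnalysis.
Context {R : realType}.
Let C : numClosedFieldType := Cplx R.

Definition is_domain (D : set C) : Prop :=
  [/\ D !=set0, open D & connected D].

(* For open D: complex differentiability at every point of D. *)
Definition holomorphic_on (D : set C) (f : C -> C) : Prop :=
  forall t, D t -> derivable f t 1.

Definition mx_deriv (M : C -> 'M[C]_3) (t : C) : 'M[C]_3 :=
  \matrix_(i, j) (fun s => M s i j)^`()%classic t.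

(* The systems have poles at x = 0 and x = 1, hence the side conditions. *)
Definition compatible (D : set C) (A B : C -> C -> 'M[C]_3) : Prop :=
  forall t x, D t -> x != 0 -> x != 1 ->
    mx_deriv (A ^~ x) t - mx_deriv (B t) x
      + (A t x *m B t x - B t x *m A t x) = 0.

(* The arguments of H are in the order t, q1, p1, q2, p2. *)
Definition hamiltonian_system (H : C -> C -> C -> C -> C -> C) (D : set C)
    (q1 p1 q2 p2 : C -> C) : Prop :=
  forall t, D t ->
  [/\ q1^`()%classic t = (fun y => H t (q1 t) y (q2 t) (p2 t))^`()%classic (p1 t),
      p1^`()%classic t = - (fun y => H t y (p1 t) (q2 t) (p2 t))^`()%classic (q1 t),
      q2^`()%classic t = (fun y => H t (q1 t) (p1 t) (q2 t) y)^`()%classic (p2 t) &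
      p2^`()%classic t = - (fun y => H t (q1 t) (p1 t) y (p2 t))^`()%classic (q2 t)].

End ComplexAnalysis.

(* th0_1, th0_2, th1, thoo_1, thoo_2, thoo_3 stand for
   theta^0_1, theta^0_2, theta^1, theta^oo_1, theta^oo_2, theta^oo_3. *)
Record exponents (F : Type) := Exponents {
  th0_1 : F; th0_2 : F; th1 : F; thoo_1 : F; thoo_2 : F; thoo_3 : F }.

Section Hamiltonian.
Context {F : fieldType}.

Definition tHV (alpha beta gamma t q p : F) : F :=
  p * (p + t) * q * (q - 1) + beta * p * q + gamma * p
  - (alpha + gamma) * t * q.

Definition tHam (th : exponents F) (t q1 p1 q2 p2 : F) : F :=
  tHV (th0_1 th + th1 th + thoo_2 th + thoo_3 th)
      (th1 th + thoo_1 th - thoo_2 th - 1)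
      (- th1 th - thoo_3 th) t q1 p1
  + tHV (th1 th + thoo_3 th)
        (th1 th + thoo_1 th - thoo_3 th - 1)
        (- th1 th) t q2 p2
  + p1 * (q2 - 1) * (p2 * (q1 + q2) - thoo_3 th).

Definition Ham (th : exponents F) (t q1 p1 q2 p2 : F) : F :=
  tHam th t q1 p1 q2 p2 / t.

End Hamiltonian.

Section LaxPair.
Context {F : fieldType}.

Definition row3 (x y z : F) : 'rV[F]_3 := \row_(j < 3) nth 0 [:: x; y; z] j.

Definition mx3 (r : seq (seq F)) : 'M[F]_3 :=
  \matrix_(i < 3, j < 3) nth 0 (nth [::] r i) j.

Context (th : exponents F) (t q1 p1 q2 p2 : F).

Definition lax_a : F :=
  t * q1 * (p1 * q1 - th0_1 th - thoo_2 th)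
  + p1 * q1 * (p1 * q1 + p2 * q2 + th1 th).

Definition lax_b : F :=
  t * q2 * (p2 * q2 - thoo_3 th)
  + p2 * q2 * (p1 * q1 + p2 * q2 + th1 th).

Definition lax_c : F :=
  - q2 * (p2 * q2 - thoo_3 th) * (q1^-1 - q2^-1) + thoo_3 th.

(* hatA1 = \hat A_1^{(0)}, hatAm1 = \hat A_0^{(-1)}, hatA0 = \hat A_0^{(0)}. *)
Definition hatA1 : 'M[F]_3 :=
  (row3 1 (- (p1 * q1)) (- (p2 * q2)))^T
    *m row3 (p1 * q1 + p2 * q2 + th1 th) 1 1.

Definition hatAm1 : 'M[F]_3 :=
  (row3 1 0 0)^T *m row3 t (- q1^-1) (- q2^-1).

Definition hatA0 : 'M[F]_3 := mx3
  [:: [:: - (p1 * q1) - p2 * q2 - th1 th - thoo_1 th; -1; -1];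
      [:: - t * q1 * (p1 * q1 - th0_1 th - thoo_2 th);
          p1 * q1 - thoo_2 th;
          p1 * q1];
      [:: - t * q2 * (p2 * q2 - thoo_3 th);
          q2 * (p2 * q2 - thoo_3 th) / q1;
          p2 * q2 - thoo_3 th]].

Definition gaugeR : 'M[F]_3 := mx3
  [:: [:: 1; 0; 0];
      [:: lax_a / (thoo_1 th - thoo_2 th); 1; 0];
      [:: (thoo_1 th - thoo_3 th)^-1
            * (lax_b + lax_a * lax_c / (thoo_1 th - thoo_2 th));
          lax_c / (thoo_2 th - thoo_3 th); 1]].

Context (u v : F).

Definition gaugeG : 'M[F]_3 := gaugeR *m diag_mx (row3 1 u v).

Definition laxA (x : F) : 'M[F]_3 :=
  invmx gaugeG
    *m ((x ^+ 2)^-1 *: hatAm1 + x^-1 *: hatA0 + (x - 1)^-1 *: hatA1)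
    *m gaugeG.

Definition laxB (x : F) : 'M[F]_3 :=
  - (t * x)^-1 *: (invmx gaugeG *m hatAm1 *m gaugeG).

End LaxPair.

(* Main.v *)
Require Import Defs.
From HB Require Import structures.
From mathcomp Require Import all_boot all_order all_algebra.
From mathcomp Require Import complex.
From mathcomp Require Import boolp classical_sets reals topology normedtype derive.
From mathcomp Require Import ring.
Set Implicit Arguments.
Unset Strict Implicit.
Unset Printing Implicit Defensive.
Import Order.TTheory GRing.Theory Num.Theory numFieldNormedType.Exports.
Local Open Scope classical_set_scope.
Local Open Scope ring_scope.

(** Write G for the gauge matrix, the hatted A for the matrices before the
gauge, and W = G' G^-1 for the connection of the gauge, where the prime is the
derivative in t. Conjugated by G, the curvature becomes the sum of A', the
commutator of A with W, - hatAm1 / (t x^2) and - 1 / (t x) times the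
commutator of A with hatAm1, where A is the hatted connection matrix. This is
a rational function of x whose only poles are 0 (of order two) and 1. So
compatibility at one t says that three matrices vanish: [curv_double] at x^-2,
[curv_simple] at (x - 1)^-1, and the coefficient of x^-1, which is [curv_infty
- curv_simple]. Here [curv_infty] always vanishes ([hatA_infty_derive]),
because hatA0 + hatA1, minus the residue at infinity, equals G diag(- thoo)
G^-1 with a constant diagonal: this is what the entries of the gauge are
chosen for.

W is lower triangular with diagonal (0, u'/u, v'/v). What remains is linear
algebra in the nine unknowns q1', p1', q2', p2', u'/u, v'/v and the three
entries w1, w2, w3 of W below the diagonal. The equations [curv_double = 0]
and [curv_simple = 0] are equivalent to eight of the unknowns being explicit
functions of w3 ([curv_finiteP]). For the six derivatives these are the
functions of the theorem, corrected by multiples of a quantity [defect] affine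
in w3. The relation [curv_infty = 0] closes the system in both directions.
From the equations, its entries (2,1) and (3,2) give
  (q1 / q2) (th0_1 + thoo_2 - p1 (q1 - q2)) defect = 0  and
  (thoo_2 - p1 (q1 - q2)) defect = 0,
and since th0_1 is not zero the two factors cannot both vanish, so the defect
does ([curv_infty_defect0]). From the flow, the same relation is triangular in
w1, w2, w3 with the differences of the thoo on the diagonal, and so forces the
values that the equations ask for ([curv_infty_gauge]). *)

(** * Explicit three by three matrices *)

Notation mx9 a b c d e f g h i :=
  (mx3 [:: [:: a; b; c]; [:: d; e; f]; [:: g; h; i]]).

Section Mx9.
Context {F : fieldType}.
Implicit Types a b c d e f g h i k : F.

Lemma mx9M a b c d e f g h i a' b' c' d' e' f' g' h' i' :
  mx9 a b c d e f g h i *m mx9 a' b' c' d' e' f' g' h' i' =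
  mx9 (a * a' + b * d' + c * g') (a * b' + b * e' + c * h')
      (a * c' + b * f' + c * i')
      (d * a' + e * d' + f * g') (d * b' + e * e' + f * h')
      (d * c' + e * f' + f * i')
      (g * a' + h * d' + i * g') (g * b' + h * e' + i * h')
      (g * c' + h * f' + i * i').
Proof.
apply/matrixP => [[[|[|[|//]]] ?]] [[|[|[|//]]] ?];
  by rewrite !mxE !big_ord_recl big_ord0 !mxE /= addr0 addrA.
Qed.

Lemma mx9D a b c d e f g h i a' b' c' d' e' f' g' h' i' :
  mx9 a b c d e f g h i + mx9 a' b' c' d' e' f' g' h' i' =
  mx9 (a + a') (b + b') (c + c') (d + d') (e + e') (f + f')
      (g + g') (h + h') (i + i').
Proof.
by apply/matrixP => [[[|[|[|//]]] ?]] [[|[|[|//]]] ?]; rewrite !mxE.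
Qed.

Lemma mx9N a b c d e f g h i :
  - mx9 a b c d e f g h i =
  mx9 (- a) (- b) (- c) (- d) (- e) (- f) (- g) (- h) (- i).
Proof.
by apply/matrixP => [[[|[|[|//]]] ?]] [[|[|[|//]]] ?]; rewrite !mxE.
Qed.

Lemma mx9Z k a b c d e f g h i :
  k *: mx9 a b c d e f g h i =
  mx9 (k * a) (k * b) (k * c) (k * d) (k * e) (k * f) (k * g) (k * h) (k * i).
Proof.
by apply/matrixP => [[[|[|[|//]]] ?]] [[|[|[|//]]] ?]; rewrite !mxE.
Qed.

Lemma row3_mul a b c a' b' c' :
  (row3 a b c)^T *m row3 a' b' c' =
  mx9 (a * a') (a * b') (a * c') (b * a') (b * b') (b * c')
      (c * a') (c * b') (c * c').
Proof.
apply/matrixP => [[[|[|[|//]]] ?]] [[|[|[|//]]] ?];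
  by rewrite !mxE big_ord1 !mxE.
Qed.

Lemma diag_row3 a b c : diag_mx (row3 a b c) = mx9 a 0 0 0 b 0 0 0 c.
Proof.
by apply/matrixP => [[[|[|[|//]]] ?]] [[|[|[|//]]] ?]; rewrite !mxE.
Qed.

Lemma mx9_eq0 a b c d e f g h i :
  mx9 a b c d e f g h i = 0 <->
  [/\ [/\ a = 0, b = 0 & c = 0], [/\ d = 0, e = 0 & f = 0]
    & [/\ g = 0, h = 0 & i = 0]].
Proof.
split=> [/matrixP M0|[[-> -> ->] [-> -> ->] [-> -> ->]]]; last first.
  by apply/matrixP => [[[|[|[|//]]] ?]] [[|[|[|//]]] ?]; rewrite !mxE.
have E (x y : nat) (lx : (x < 3)%N) (ly : (y < 3)%N) :=
  M0 (Ordinal lx) (Ordinal ly).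
by split; split; [have := E 0 0 isT isT|have := E 0 1 isT isT
  |have := E 0 2 isT isT|have := E 1 0 isT isT|have := E 1 1 isT isT
  |have := E 1 2 isT isT|have := E 2 0 isT isT|have := E 2 1 isT isT
  |have := E 2 2 isT isT]; rewrite !mxE.
Qed.

End Mx9.

Definition mx9E {F : fieldType} :=
  (@row3_mul F, @diag_row3 F, @mx9M F, @mx9N F, @mx9Z F, @mx9D F).

(** * The zero-curvature equations at one value of t *)

Section LinearCombination.
Context {F : fieldType}.
Implicit Types k e f x y : F.

Lemma lin0 k e f : e = 0 -> f = 0 -> k * e + f = 0.
Proof. by move=> -> ->; rewrite mulr0 addr0. Qed.

(** With [lin0], states an equation as a linear combination of known ones, so
that an identity of rational functions is all that is left to check. *)
Lemma eq_by_lin0 x y e : e = 0 -> x - y = e -> x = y.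
Proof. by move=> -> /subr0_eq. Qed.

Lemma eq_div_of_mul k x y : k != 0 -> k * x = y -> x = y / k.
Proof. by move=> k0 <-; field. Qed.

End LinearCombination.

Section ZeroCurvature.
Context {F : fieldType} (th : exponents F) (t q1 p1 q2 p2 : F).

(** [tflow_q1], ..., [tflow_p2] are the components of t times the Hamiltonian
vector field (see [is_derive_Ham_p1] and its companions); [tflow_u] and
[tflow_v] are the right-hand sides of the two gauge equations. *)
Definition tflow_q1 : F :=
  (2 * p1 + t) * q1 * (q1 - 1) + (th1 th + thoo_1 th - thoo_2 th - 1) * q1
  - th1 th - thoo_3 th + (q2 - 1) * (p2 * (q1 + q2) - thoo_3 th).

Definition tflow_p1 : F :=
  - (p1 * (p1 + t) * (2 * q1 - 1)
     + (th1 th + thoo_1 th - thoo_2 th - 1) * p1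
     - (th0_1 th + thoo_2 th) * t + p1 * p2 * (q2 - 1)).

Definition tflow_q2 : F :=
  (2 * p2 + t) * q2 * (q2 - 1) + (th1 th + thoo_1 th - thoo_3 th - 1) * q2
  - th1 th + p1 * (q2 - 1) * (q1 + q2).

Definition tflow_p2 : F :=
  - (p2 * (p2 + t) * (2 * q2 - 1)
     + (th1 th + thoo_1 th - thoo_3 th - 1) * p2
     - thoo_3 th * t + p1 * (p2 * (q1 + q2) - thoo_3 th)
     + p1 * p2 * (q2 - 1)).

Definition tflow_u : F :=
  q2 * (p2 * q2 - p2 - thoo_3 th) - q1 * (2 * p1 + p2 + t) - th1 th.

Definition tflow_v : F :=
  - p1 * (q1 + q2) - (2 * p2 + t) * q2 - th1 th.

(** In the rest of the section the derivatives are independent unknowns, and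
[dhatA1], [dhatAm1], [dhatA0] are the formal derivatives of the hatted
matrices. *)
Context (dq1 dp1 dq2 dp2 : F).

Definition dhatA1 : 'M[F]_3 :=
  (row3 0 (- (dp1 * q1 + p1 * dq1)) (- (dp2 * q2 + p2 * dq2)))^T
    *m row3 (p1 * q1 + p2 * q2 + th1 th) 1 1
  + (row3 1 (- (p1 * q1)) (- (p2 * q2)))^T
    *m row3 (dp1 * q1 + p1 * dq1 + (dp2 * q2 + p2 * dq2)) 0 0.

Definition dhatAm1 : 'M[F]_3 :=
  (row3 1 0 0)^T *m row3 1 (q1 ^- 2 * dq1) (q2 ^- 2 * dq2).

Definition dhatA0 : 'M[F]_3 := mx3
  [:: [:: - (dp1 * q1 + p1 * dq1) - (dp2 * q2 + p2 * dq2); 0; 0];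
      [:: - (q1 + t * dq1) * (p1 * q1 - th0_1 th - thoo_2 th)
          - t * q1 * (dp1 * q1 + p1 * dq1);
          dp1 * q1 + p1 * dq1;
          dp1 * q1 + p1 * dq1];
      [:: - (q2 + t * dq2) * (p2 * q2 - thoo_3 th)
          - t * q2 * (dp2 * q2 + p2 * dq2);
          (dq2 * (p2 * q2 - thoo_3 th) + q2 * (dp2 * q2 + p2 * dq2)) / q1
          - q2 * (p2 * q2 - thoo_3 th) / q1 ^+ 2 * dq1;
          dp2 * q2 + p2 * dq2]].

Definition comm3 (M N : 'M[F]_3) : 'M[F]_3 := M *m N - N *m M.

Local Notation Am1 := (hatAm1 t q1 q2).
Local Notation A0 := (hatA0 th t q1 p1 q2 p2).
Local Notation A1 := (hatA1 th q1 p1 q2 p2).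

(** The coefficients of x^-2 and of (x - 1)^-1 in the conjugated curvature. *)
Definition curv_double (W : 'M[F]_3) : 'M[F]_3 :=
  dhatAm1 + comm3 Am1 W - t^-1 *: (Am1 + comm3 A0 Am1).

Definition curv_simple (W : 'M[F]_3) : 'M[F]_3 :=
  dhatA1 + comm3 A1 W - t^-1 *: comm3 A1 Am1.

(** The derivative of hatA0 + hatA1, minus the residue at infinity, along the
connection W. *)
Definition curv_infty (W : 'M[F]_3) : 'M[F]_3 :=
  dhatA0 + dhatA1 + comm3 (A0 + A1) W.

Context (w1 w2 w3 U V : F).
Local Notation W := (mx9 0 0 0 w1 U 0 w2 w3 V).

(** It vanishes exactly when w3 is - 1 / t times the entry (3,2) of hatA0. *)
Definition defect : F := t * q1 * w3 + q2 * (p2 * q2 - thoo_3 th).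

Hypotheses (t0 : t != 0) (q10 : q1 != 0) (q20 : q2 != 0).

(** As hatAm1 and hatA1 have rank one, either equation reads c y + z r = 0 with
c and r the column and the row of the residue, so that few entries are
independent: the first column of the double pole gives w1 and w2,
its first row gives q1' and q2', the first row of the simple pole gives
u'/u + w3 and v'/v, and its diagonal gives p1' and p2'. Nothing fixes w3, which
is why the defect occurs. *)
Lemma curv_finiteP :
  curv_double W = 0 /\ curv_simple W = 0 <->
  [/\ w1 = q1 * (p1 * q1 - th0_1 th - thoo_2 th) /\
      w2 = q2 * (p2 * q2 - thoo_3 th),
      t * dq1 = tflow_q1 + (q1 / q2 - 1) * defect /\
      t * dp1 = tflow_p1 - p1 / q2 * defect,
      t * dq2 = tflow_q2 /\ t * dp2 = tflow_p2 + p1 / q2 * defect &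
      t * q1 * U = tflow_u - defect /\ t * q2 * V = tflow_v].
Proof.
rewrite /curv_double /curv_simple /comm3 /dhatA1 /dhatAm1 /hatAm1 /hatA1.
rewrite /hatA0 !mx9E !mx9_eq0 /tflow_q1 /tflow_p1 /tflow_q2 /tflow_p2.
rewrite /tflow_u /tflow_v /defect.
have z0 : 0 = 0 :> F by [].
split.
(* The multipliers solve the equations: those of [E12], [E13], [S22], [S33]
   normalize the derivative sought, the others cancel the other unknowns. *)
- move=> [[[_ E12 E13] [E21 _ _] [E31 _ _]] [[_ S12 S13] [_ S22 _] [_ _ S33]]].
  split; split.
  + apply: (eq_by_lin0 (lin0 (- t^-1) E21 z0)); field; rewrite ?t0 ?q10 ?q20 //.
  + apply: (eq_by_lin0 (lin0 (- t^-1) E31 z0)); field; rewrite ?t0 ?q10 ?q20 //.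
  + apply: (eq_by_lin0
      (lin0 (t * q1 ^+ 2) E12 (lin0 (t * q1) S12 z0))); field;
      rewrite ?t0 ?q10 ?q20 //.
  + apply: (eq_by_lin0 (lin0 (- t / q1) S22 (lin0 q1^-1 E21
      (lin0 (- p1 * t * q1) E12 (lin0 (- p1 * t) S12 z0))))); field;
      rewrite ?t0 ?q10 ?q20 //.
  + apply: (eq_by_lin0
      (lin0 (t * q2 ^+ 2) E13 (lin0 (t * q2) S13 z0))); field;
      rewrite ?t0 ?q10 ?q20 //.
  + apply: (eq_by_lin0 (lin0 (- t / q2) S33 (lin0 q2^-1 E31
      (lin0 (- p2 * t * q2) E13 (lin0 (- p2 * t) S13 z0))))); field;
      rewrite ?t0 ?q10 ?q20 //.
  + apply: (eq_by_lin0 (lin0 (t * q1) S12 z0)); field; rewrite ?t0 ?q10 ?q20 //.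
  + apply: (eq_by_lin0 (lin0 (t * q2) S13 z0)); field; rewrite ?t0 ?q10 ?q20 //.
have tq1 : t * q1 != 0 by rewrite mulf_neq0.
have tq2 : t * q2 != 0 by rewrite mulf_neq0.
move=> [[-> ->] [/(eq_div_of_mul t0) -> /(eq_div_of_mul t0) ->]].
move=> [/(eq_div_of_mul t0) -> /(eq_div_of_mul t0) ->].
move=> [/(eq_div_of_mul tq1) -> /(eq_div_of_mul tq2) ->].
by split; split; split; field; rewrite ?t0 ?q10 ?q20 //.
Qed.

(** After substitution the entries (2,1) and (3,2) of [curv_infty] are
multiples of the defect. Both multipliers contain p1 (q1 - q2), and the
combination that removes it is th0_1 times the defect. *)
Lemma curv_infty_defect0 : th0_1 th != 0 -> curv_infty W = 0 ->
  w1 = q1 * (p1 * q1 - th0_1 th - thoo_2 th) ->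
  w2 = q2 * (p2 * q2 - thoo_3 th) ->
  t * dq1 = tflow_q1 + (q1 / q2 - 1) * defect ->
  t * dp1 = tflow_p1 - p1 / q2 * defect ->
  t * dq2 = tflow_q2 ->
  t * dp2 = tflow_p2 + p1 / q2 * defect ->
  t * q1 * U = tflow_u - defect ->
  t * q2 * V = tflow_v ->
  defect = 0.
Proof.
rewrite /curv_infty /comm3 /dhatA0 /dhatA1 /hatA1 /hatA0 !mx9E mx9_eq0.
move=> th0 [_ [S21 _ _] [_ S32 _]] Ew1 Ew2.
have tq1 : t * q1 != 0 by rewrite mulf_neq0.
have tq2 : t * q2 != 0 by rewrite mulf_neq0.
move=> /(eq_div_of_mul t0) Eq1 /(eq_div_of_mul t0) Ep1.
move=> /(eq_div_of_mul t0) Eq2 /(eq_div_of_mul t0) Ep2.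
move=> /(eq_div_of_mul tq1) EU /(eq_div_of_mul tq2) EV.
apply: (mulfI th0); rewrite mulr0.
apply: (eq_by_lin0 (lin0 (q2 / q1) S21 (lin0 (- (t * q1)) S32 (erefl 0)))).
rewrite Ew1 Ew2 Eq1 Ep1 Eq2 Ep2 EU EV.
rewrite /tflow_q1 /tflow_p1 /tflow_q2 /tflow_p2 /tflow_u /tflow_v /defect.
by field; rewrite ?t0 ?q10 ?q20 //.
Qed.

(** Along the flow the entries (3,2), (2,1), (3,1) of [curv_infty] determine
w3, w1, w2 in this order, with leading coefficients thoo_2 - thoo_3,
thoo_1 - thoo_2, thoo_1 - thoo_3. *)
Lemma curv_infty_gauge :
  thoo_1 th != thoo_2 th -> thoo_1 th != thoo_3 th -> thoo_2 th != thoo_3 th ->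
  curv_infty W = 0 ->
  t * dq1 = tflow_q1 -> t * dp1 = tflow_p1 ->
  t * dq2 = tflow_q2 -> t * dp2 = tflow_p2 ->
  t * q1 * U = tflow_u -> t * q2 * V = tflow_v ->
  [/\ w1 = q1 * (p1 * q1 - th0_1 th - thoo_2 th),
      w2 = q2 * (p2 * q2 - thoo_3 th) & defect = 0].
Proof.
rewrite /curv_infty /comm3 /dhatA0 /dhatA1 /hatA1 /hatA0 !mx9E mx9_eq0.
rewrite -subr_eq0 -[thoo_1 th == thoo_3 th]subr_eq0.
rewrite -[thoo_2 th == thoo_3 th]subr_eq0.
move=> th12 th13 th23 [_ [S21 _ _] [S31 S32 _]].
have tq1 : t * q1 != 0 by rewrite mulf_neq0.
have tq2 : t * q2 != 0 by rewrite mulf_neq0.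
move=> /(eq_div_of_mul t0) Eq1 /(eq_div_of_mul t0) Ep1.
move=> /(eq_div_of_mul t0) Eq2 /(eq_div_of_mul t0) Ep2.
move=> /(eq_div_of_mul tq1) EU /(eq_div_of_mul tq2) EV.
have D0 : defect = 0.
  apply: (mulfI th23); rewrite mulr0.
  apply: (eq_by_lin0 (lin0 (t * q1) S32 (erefl 0))).
  rewrite ?Eq1 ?Ep1 ?Eq2 ?Ep2 ?EU ?EV.
  rewrite /tflow_q1 /tflow_p1 /tflow_q2 /tflow_p2 /tflow_u /tflow_v /defect.
  by field; rewrite ?t0 ?q10 ?q20 //.
have Ew1 : w1 = q1 * (p1 * q1 - th0_1 th - thoo_2 th).
  apply: (mulfI th12); apply: (eq_by_lin0 (lin0 1 S21 (erefl 0))).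
  rewrite ?Eq1 ?Ep1 ?Eq2 ?Ep2 ?EU ?EV.
  rewrite /tflow_q1 /tflow_p1 /tflow_q2 /tflow_p2 /tflow_u /tflow_v.
  by field; rewrite ?t0 ?q10 ?q20 //.
split=> //; apply: (mulfI th13); apply: (eq_by_lin0 (lin0 1 S31 (erefl 0))).
have -> : w3 = - q2 * (p2 * q2 - thoo_3 th) / (t * q1).
  by apply: eq_div_of_mul => //; apply: (eq_by_lin0 (lin0 1 D0 (erefl 0)));
    rewrite /defect; ring.
rewrite Ew1 Eq1 Ep1 Eq2 Ep2 EV.
rewrite /tflow_q1 /tflow_p1 /tflow_q2 /tflow_p2 /tflow_u /tflow_v.
by field; rewrite ?t0 ?q10 ?q20 //.
Qed.

Lemma curv_flowP : th0_1 th != 0 ->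
  thoo_1 th != thoo_2 th -> thoo_1 th != thoo_3 th -> thoo_2 th != thoo_3 th ->
  curv_infty W = 0 ->
  curv_double W = 0 /\ curv_simple W = 0 <->
  [/\ t * dq1 = tflow_q1, t * dp1 = tflow_p1, t * dq2 = tflow_q2
    & t * dp2 = tflow_p2] /\
  (t * q1 * U = tflow_u /\ t * q2 * V = tflow_v).
Proof.
move=> th0 th12 th13 th23 S0; split.
  move=> /curv_finiteP [[Ew1 Ew2] [Eq1 Ep1] [Eq2 Ep2] [EU EV]].
  have D0 := curv_infty_defect0 th0 S0 Ew1 Ew2 Eq1 Ep1 Eq2 Ep2 EU EV.
  by move: Eq1 Ep1 Ep2 EU; rewrite D0 !mulr0 !addr0 !subr0.
move=> [[Eq1 Ep1 Eq2 Ep2] [EU EV]]; apply/curv_finiteP.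
have [Ew1 Ew2 D0] :=
  curv_infty_gauge th12 th13 th23 S0 Eq1 Ep1 Eq2 Ep2 EU EV.
by rewrite D0 !mulr0 !addr0 !subr0.
Qed.

End ZeroCurvature.

(** * Derivatives of functions and of matrices *)

Section ScalarDerivative.
Context {K : numFieldType}.
Implicit Types (f g : K -> K) (t df dg c : K).

Lemma is_derive1E f t df : is_derive t 1 f df -> f^`()%classic t = df.
Proof. by move=> fd; rewrite derive1E; exact: derive_val. Qed.

Lemma is_derive1P f t : derivable f t 1 -> is_derive t 1 f (f^`()%classic t).
Proof. by move=> fd; rewrite derive1E; exact: derivableP. Qed.

Lemma is_derive_fctid t : is_derive t 1 (fun s : K => s) 1.
Proof. exact: is_derive_id. Qed.

Lemma is_derive_fctcst c t : is_derive t 1 (fun=> c : K) 0.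
Proof. exact: is_derive_cst. Qed.

Lemma is_derive_fctD f g t df dg : is_derive t 1 f df -> is_derive t 1 g dg ->
  is_derive t 1 (fun s => f s + g s) (df + dg).
Proof. exact: is_deriveD. Qed.

Lemma is_derive_fctN f t df : is_derive t 1 f df ->
  is_derive t 1 (fun s => - f s) (- df).
Proof. exact: is_deriveN. Qed.

Lemma is_derive_fctM f g t df dg : is_derive t 1 f df -> is_derive t 1 g dg ->
  is_derive t 1 (fun s => f s * g s) (df * g t + f t * dg).
Proof.
move=> fd gd; apply: is_derive_eq (is_deriveM fd gd) _.
by rewrite addrC /GRing.scale /= [g t * _]mulrC.
Qed.

Lemma is_derive_fctV f t df : f t != 0 -> is_derive t 1 f df ->
  is_derive t 1 (fun s => (f s)^-1) (- (f t) ^- 2 * df).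
Proof.
move=> f0 fd; split; first exact: derivableV.
by rewrite deriveV// (derive_val).
Qed.

Lemma is_derive_near f g t df : (\forall s \near t, f s = g s) ->
  is_derive t 1 f df -> is_derive t 1 g df.
Proof. move=> fg; exact: near_eq_is_derive. Qed.

Lemma is_derive_unique f t df dg :
  is_derive t 1 f df -> is_derive t 1 f dg -> df = dg.
Proof. by move=> /is_derive1E <- /is_derive1E. Qed.

Lemma derivable_near_neq0 f t :
  derivable f t 1 -> f t != 0 -> \forall s \near t, f s != 0.
Proof.
move=> fd; have fc : {for t, continuous f}.
  exact/differentiable_continuous/derivable1_diffP.
exact: (cvgr_neq0 _ fc).
Qed.

Lemma derivable_prod_seq (I : Type) (r : seq I) (f : I -> K -> K) t :
  (forall i, derivable (f i) t 1) ->
  derivable (fun s => \prod_(i <- r) f i s) t 1.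
Proof.
move=> fd; elim: r => [|i r IHr].
  by under eq_fun do rewrite big_nil; exact: derivable_cst.
by under eq_fun do rewrite big_cons; exact: derivableM.
Qed.

Lemma derivable_sum_seq (I : Type) (r : seq I) (f : I -> K -> K) t :
  (forall i, derivable (f i) t 1) ->
  derivable (fun s => \sum_(i <- r) f i s) t 1.
Proof.
move=> fd; elim: r => [|i r IHr].
  by under eq_fun do rewrite big_nil; exact: derivable_cst.
by under eq_fun do rewrite big_cons; exact: derivableD.
Qed.

Lemma is_derive_sum_seq (I : Type) (r : seq I) (f : I -> K -> K) t
    (df : I -> K) :
  (forall i, is_derive t 1 (f i) (df i)) ->
  is_derive t 1 (fun s => \sum_(i <- r) f i s) (\sum_(i <- r) df i).
Proof.
move=> fd; elim: r => [|i r IHr].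
  by under eq_fun do rewrite big_nil; rewrite big_nil; exact: is_derive_cst.
by under eq_fun do rewrite big_cons; rewrite big_cons; exact: is_deriveD.
Qed.

End ScalarDerivative.

(** Computes the derivative of a rational expression. The premises are class
instances: plain application would let instance search choose the derivative
and lose the form given by the rules above. *)
Ltac is_derive_rules := repeat first
  [ eassumption
  | notypeclasses refine (is_derive_fctcst _ _)
  | notypeclasses refine (is_derive_fctid _)
  | notypeclasses refine (is_derive_fctD _ _)
  | notypeclasses refine (is_derive_fctN _)
  | notypeclasses refine (is_derive_fctM _ _)
  | notypeclasses refine (is_derive_fctV _ _) ].

Section MatrixDerivative.
Context {K : numFieldType}.
Implicit Types (t df k : K).

(** Entrywise, as for [mx_deriv], and with the derivative as a parameter so that
existence is part of the statement. *)
Definition mx_is_derive m n (M : K -> 'M[K]_(m, n)) (t : K) (dM : 'M[K]_(m, n)) :=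
  forall i j, is_derive t 1 (fun s => M s i j) (dM i j).

Lemma mx_is_derive_eq m n (M : K -> 'M[K]_(m, n)) t dM dM' :
  mx_is_derive M t dM -> dM = dM' -> mx_is_derive M t dM'.
Proof. by move=> ? <-. Qed.

Lemma mx_is_derive_unique m n (M : K -> 'M[K]_(m, n)) t dM dM' :
  mx_is_derive M t dM -> mx_is_derive M t dM' -> dM = dM'.
Proof.
by move=> Md Md'; apply/matrixP => i j; exact: is_derive_unique (Md i j) _.
Qed.

Lemma mx_is_derive_near m n (M N : K -> 'M[K]_(m, n)) t dM :
  (\forall s \near t, M s = N s) -> mx_is_derive M t dM -> mx_is_derive N t dM.
Proof.
move=> MN Md i j; apply: is_derive_near (Md i j).
by near=> s; rewrite (near MN s).
Unshelve. all: end_near. Qed.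

Lemma mx_is_derive_cst m n (A : 'M[K]_(m, n)) t : mx_is_derive (fun=> A) t 0.
Proof. by move=> i j; rewrite mxE; exact: is_derive_cst. Qed.

Lemma mx_is_deriveD m n (M N : K -> 'M[K]_(m, n)) t dM dN :
  mx_is_derive M t dM -> mx_is_derive N t dN ->
  mx_is_derive (fun s => M s + N s) t (dM + dN).
Proof.
by move=> Md Nd i j; rewrite mxE; under eq_fun do rewrite mxE; exact: is_deriveD.
Qed.

Lemma mx_is_deriveZ m n (f : K -> K) df (A : 'M[K]_(m, n)) t :
  is_derive t 1 f df -> mx_is_derive (fun s => f s *: A) t (df *: A).
Proof.
move=> fd i j; under eq_fun do rewrite mxE; rewrite mxE.
apply: is_derive_eq (is_derive_fctM fd (is_derive_fctcst _ _)) _.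
by rewrite mulr0 addr0.
Qed.

Lemma mx_is_deriveZr m n (k : K) (M : K -> 'M[K]_(m, n)) t dM :
  mx_is_derive M t dM -> mx_is_derive (fun s => k *: M s) t (k *: dM).
Proof.
move=> Md i j; under eq_fun do rewrite mxE; rewrite mxE.
apply: is_derive_eq (is_derive_fctM (is_derive_fctcst _ _) (Md i j)) _.
by rewrite mul0r add0r.
Qed.

Lemma mx_is_deriveM m n p (M : K -> 'M[K]_(m, n)) (N : K -> 'M[K]_(n, p))
    t dM dN :
  mx_is_derive M t dM -> mx_is_derive N t dN ->
  mx_is_derive (fun s => M s *m N s) t (dM *m N t + M t *m dN).
Proof.
move=> Md Nd i j; under eq_fun do rewrite mxE.
rewrite !mxE -big_split /=; apply: is_derive_sum_seq => k.
exact: is_derive_fctM.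
Qed.

Lemma derivable_det n (M : K -> 'M[K]_n) t :
  (forall i j, derivable (fun s => M s i j) t 1) ->
  derivable (fun s => \det (M s)) t 1.
Proof.
move=> Md; apply: derivable_sum_seq => /= s.
apply: derivableM; first exact: derivable_cst.
exact: derivable_prod_seq.
Qed.

Lemma derivable_adj n (M : K -> 'M[K]_n) t :
  (forall i j, derivable (fun s => M s i j) t 1) ->
  forall i j, derivable (fun s => (\adj (M s)) i j) t 1.
Proof.
move=> Md i j; under eq_fun do rewrite mxE.
apply: derivableM; first exact: derivable_cst.
by apply: derivable_det => k l; under eq_fun do rewrite !mxE; exact: Md.
Qed.

(** Cramer's rule shows that the inverse is derivable; the value of the
derivative then follows from differentiating the constant G^-1 G. *)
Lemma mx_is_derive_inv n (G : K -> 'M[K]_n) t dG :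
  G t \in unitmx -> mx_is_derive G t dG ->
  mx_is_derive (fun s => invmx (G s)) t (- (invmx (G t) *m dG *m invmx (G t))).
Proof.
move=> Gu Gd.
have Gdv i j : derivable (fun s => G s i j) t 1 by case: (Gd i j).
have detd := derivable_det Gdv.
have det0 : \det (G t) != 0 by rewrite -unitfE -unitmxE.
have Gunear : \forall s \near t, G s \in unitmx.
  near=> s; rewrite unitmxE unitfE.
  by near: s; exact: derivable_near_neq0.
pose H s := (\det (G s))^-1 *: \adj (G s).
have HE : \forall s \near t, H s = invmx (G s).
  by near=> s; rewrite /H /invmx (near Gunear s).
have Hdv i j : derivable (fun s => H s i j) t 1.
  under eq_fun do rewrite mxE.
  by apply: derivableM; [exact: derivableV|exact: derivable_adj].
have Hd : mx_is_derive H t (\matrix_(i, j) 'D_1 (fun s => H s i j) t).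
  by move=> i j; rewrite mxE; exact: derivableP.
have {Hd}[dH Hd] : exists dH, mx_is_derive (fun s => invmx (G s)) t dH.
  by eexists; exact: mx_is_derive_near HE Hd.
suff <- : dH = - (invmx (G t) *m dG *m invmx (G t)) by [].
have := mx_is_deriveM Hd Gd.
have /mx_is_derive_unique /[apply] :
    mx_is_derive (fun s => invmx (G s) *m G s) t 0.
  apply: mx_is_derive_near (mx_is_derive_cst 1%:M t).
  by near=> s; rewrite mulVmx// (near Gunear s).
move=> /esym/eqP; rewrite addr_eq0 => /eqP E.
by rewrite -[LHS](mulmxK Gu) E mulNmx.
Unshelve. all: end_near. Qed.

Lemma mx_is_derive_conj n (G X : K -> 'M[K]_n) t dG dX :
  let W := dG *m invmx (G t) in
  mx_is_derive G t dG -> G t \in unitmx -> mx_is_derive X t dX ->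
  mx_is_derive (fun s => invmx (G s) *m X s *m G s) t
    (invmx (G t) *m (dX + (X t *m W - W *m X t)) *m G t).
Proof.
move=> W Gd Gu Xd.
apply: mx_is_derive_eq
  (mx_is_deriveM (mx_is_deriveM (mx_is_derive_inv Gu Gd) Xd) Gd) _.
rewrite /W !(mulmxDl, mulmxDr, mulNmx, mulmxN) -!mulmxA mulVmx// mulmx1.
by rewrite [- _ + _]addrC addrAC -addrA.
Qed.

End MatrixDerivative.

(** * Derivatives of the Lax matrices *)

Section LaxDerivative.
Context {K : numFieldType} (th : exponents K).
Context (q1 p1 q2 p2 u v : K -> K) (t dq1 dp1 dq2 dp2 du dv : K).
Hypotheses (q1d : is_derive t 1 q1 dq1) (p1d : is_derive t 1 p1 dp1).
Hypotheses (q2d : is_derive t 1 q2 dq2) (p2d : is_derive t 1 p2 dp2).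
Hypotheses (ud : is_derive t 1 u du) (vd : is_derive t 1 v dv).
Hypotheses (q10 : q1 t != 0) (q20 : q2 t != 0).
Hypotheses (u0 : u t != 0) (v0 : v t != 0).

Lemma mx_is_derive_row3 (f g h : K -> K) df dg dh :
  is_derive t 1 f df -> is_derive t 1 g dg -> is_derive t 1 h dh ->
  mx_is_derive (fun s => row3 (f s) (g s) (h s)) t (row3 df dg dh).
Proof.
move=> fd gd hd i [[|[|[|//]]] ?]; under eq_fun do rewrite mxE; rewrite mxE;
  by [exact: fd|exact: gd|exact: hd].
Qed.

Lemma mx_is_derive_tr m n (M : K -> 'M[K]_(m, n)) dM :
  mx_is_derive M t dM -> mx_is_derive (fun s => (M s)^T) t dM^T.
Proof.
by move=> Md i j; under eq_fun do rewrite mxE; rewrite mxE; exact: Md.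
Qed.

Lemma mx_is_derive9 (a b c d e f g h i : K -> K) da db dc dd de df dg dh di :
  is_derive t 1 a da -> is_derive t 1 b db -> is_derive t 1 c dc ->
  is_derive t 1 d dd -> is_derive t 1 e de -> is_derive t 1 f df ->
  is_derive t 1 g dg -> is_derive t 1 h dh -> is_derive t 1 i di ->
  mx_is_derive
    (fun s => mx9 (a s) (b s) (c s) (d s) (e s) (f s) (g s) (h s) (i s)) t
    (mx9 da db dc dd de df dg dh di).
Proof.
move=> H1 H2 H3 H4 H5 H6 H7 H8 H9 [[|[|[|//]]] ?] [[|[|[|//]]] ?];
  under eq_fun do rewrite mxE; rewrite mxE;
  [exact: H1|exact: H2|exact: H3|exact: H4|exact: H5|exact: H6
  |exact: H7|exact: H8|exact: H9].
Qed.

Lemma hatAm1_derive : mx_is_derive (fun s => hatAm1 s (q1 s) (q2 s)) t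
  (dhatAm1 (q1 t) (q2 t) dq1 dq2).
Proof.
apply: mx_is_derive_eq.
  apply: mx_is_deriveM; first exact: mx_is_derive_cst.
  by notypeclasses refine (mx_is_derive_row3 _ _ _); is_derive_rules.
by rewrite mul0mx add0r !mulNr !opprK.
Qed.

Lemma hatA1_derive : mx_is_derive
  (fun s => hatA1 th (q1 s) (p1 s) (q2 s) (p2 s)) t
  (dhatA1 th (q1 t) (p1 t) (q2 t) (p2 t) dq1 dp1 dq2 dp2).
Proof.
apply: mx_is_derive_eq.
  apply: mx_is_deriveM; [apply: mx_is_derive_tr|];
    by notypeclasses refine (mx_is_derive_row3 _ _ _); is_derive_rules.
by rewrite addr0.
Qed.

Lemma hatA0_derive : mx_is_derive
  (fun s => hatA0 th s (q1 s) (p1 s) (q2 s) (p2 s)) t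
  (dhatA0 th t (q1 t) (p1 t) (q2 t) (p2 t) dq1 dp1 dq2 dp2).
Proof.
notypeclasses refine (mx_is_derive9 _ _ _ _ _ _ _ _ _);
  try exact: is_derive_fctcst.
all: notypeclasses refine (is_derive_eq _ _); [is_derive_rules|by cbv beta; field].
Qed.

Lemma gaugeGE (s x1 y1 x2 y2 u' v' : K) :
  gaugeG th s x1 y1 x2 y2 u' v' =
  mx9 1 0 0
      (lax_a th s x1 y1 x2 y2 / (thoo_1 th - thoo_2 th)) u' 0
      ((thoo_1 th - thoo_3 th)^-1 * (lax_b th s x1 y1 x2 y2
        + lax_a th s x1 y1 x2 y2 * lax_c th x1 x2 y2
          / (thoo_1 th - thoo_2 th)))
      (lax_c th x1 x2 y2 / (thoo_2 th - thoo_3 th) * u') v'.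
Proof.
by rewrite /gaugeG /gaugeR !mx9E !(mulr0, mulr1, mul0r, mul1r, addr0, add0r).
Qed.

Lemma gaugeG_unit (s x1 y1 x2 y2 u' v' : K) : u' != 0 -> v' != 0 ->
  gaugeG th s x1 y1 x2 y2 u' v' \in unitmx.
Proof.
move=> u'0 v'0; rewrite gaugeGE unitmxE det_trig; last first.
  by apply/is_trig_mxP => [[[|[|[|//]]] ?]] [[|[|[|//]]] ?] //; rewrite mxE.
by rewrite !big_ord_recr big_ord0 /= !mxE /= !mul1r unitfE mulf_neq0.
Qed.

(** Only the shape of the derivative of G matters: the entries below the
diagonal never have to be computed. *)
Lemma gaugeG_derive : exists x1 x2 x3, mx_is_derive
  (fun s => gaugeG th s (q1 s) (p1 s) (q2 s) (p2 s) (u s) (v s)) t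
  (mx9 0 0 0 x1 du 0 x2 x3 dv).
Proof.
do 3!eexists; under eq_fun do rewrite gaugeGE.
rewrite /lax_a /lax_b /lax_c.
by notypeclasses refine (mx_is_derive9 _ _ _ _ _ _ _ _ _); is_derive_rules.
Qed.

Lemma gauge_connection x1 x2 x3
    (G := gaugeG th t (q1 t) (p1 t) (q2 t) (p2 t) (u t) (v t)) :
  exists w1 w2 w3, mx9 0 0 0 x1 du 0 x2 x3 dv *m invmx G =
    mx9 0 0 0 w1 (du / u t) 0 w2 w3 (dv / v t).
Proof.
have Gu : G \in unitmx by exact: gaugeG_unit.
rewrite /G gaugeGE in Gu *.
set g1 := _ / _ in Gu *; set g2 := _ * (_ + _) in Gu *.
set g3 := _ / _ * _ in Gu *.
exists (x1 - du / u t * g1), (x2 - (x3 - dv / v t * g3) / u t * g1 - dv / v t * g2).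
exists ((x3 - dv / v t * g3) / u t).
apply: (can_inj (mulmxK Gu)); rewrite mulmxKV// mx9M.
by congr (mx9 _ _ _ _ _ _ _ _ _); field; rewrite ?u0 ?v0.
Qed.

(** The gauge diagonalizes the residue at infinity. *)
Lemma hatA_infty (s x1 y1 x2 y2 u' v' : K) : x1 != 0 -> x2 != 0 ->
  thoo_1 th != thoo_2 th -> thoo_1 th != thoo_3 th -> thoo_2 th != thoo_3 th ->
  (hatA0 th s x1 y1 x2 y2 + hatA1 th x1 y1 x2 y2)
    *m gaugeG th s x1 y1 x2 y2 u' v' =
  gaugeG th s x1 y1 x2 y2 u' v'
    *m diag_mx (row3 (- thoo_1 th) (- thoo_2 th) (- thoo_3 th)).
Proof.
rewrite -[thoo_1 th == thoo_2 th]subr_eq0 -[thoo_1 th == thoo_3 th]subr_eq0.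
rewrite -[thoo_2 th == thoo_3 th]subr_eq0 => x10 x20 th12 th13 th23.
rewrite gaugeGE /hatA0 /hatA1 !mx9E /lax_a /lax_b /lax_c.
by congr (mx9 _ _ _ _ _ _ _ _ _); field; rewrite ?x10 ?x20 ?th12 ?th13 ?th23.
Qed.

Local Notation G :=
  (gaugeG th t (q1 t) (p1 t) (q2 t) (p2 t) (u t) (v t)).

(** Differentiating (hatA0 + hatA1) G = G diag(- thoo). *)
Lemma hatA_infty_derive W dG :
  thoo_1 th != thoo_2 th -> thoo_1 th != thoo_3 th -> thoo_2 th != thoo_3 th ->
  mx_is_derive
    (fun s => gaugeG th s (q1 s) (p1 s) (q2 s) (p2 s) (u s) (v s)) t dG ->
  W = dG *m invmx G ->
  curv_infty th t (q1 t) (p1 t) (q2 t) (p2 t) dq1 dp1 dq2 dp2 W = 0.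
Proof.
move=> th12 th13 th23 Gd ->.
have Gu : G \in unitmx by exact: gaugeG_unit.
pose L := diag_mx (row3 (- thoo_1 th) (- thoo_2 th) (- thoo_3 th)).
have CG : \forall s \near t,
    gaugeG th s (q1 s) (p1 s) (q2 s) (p2 s) (u s) (v s) *m L =
    (hatA0 th s (q1 s) (p1 s) (q2 s) (p2 s)
     + hatA1 th (q1 s) (p1 s) (q2 s) (p2 s))
      *m gaugeG th s (q1 s) (p1 s) (q2 s) (p2 s) (u s) (v s).
  have q1n : \forall s \near t, q1 s != 0.
    by case: q1d => q1'd _; exact: derivable_near_neq0.
  have q2n : \forall s \near t, q2 s != 0.
    by case: q2d => q2'd _; exact: derivable_near_neq0.
  by near=> s; rewrite hatA_infty ?(near q1n s) ?(near q2n s).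
have := mx_is_derive_unique
  (mx_is_derive_near CG (mx_is_deriveM Gd (mx_is_derive_cst L t)))
  (mx_is_deriveM (mx_is_deriveD hatA0_derive hatA1_derive) Gd).
rewrite mulmx0 addr0 => E.
apply: (can_inj (mulmxK Gu)); rewrite mul0mx /curv_infty /comm3.
rewrite mulmxDl mulmxBl addrA -!mulmxA mulVmx// mulmx1 -E.
by rewrite hatA_infty// [invmx _ *m _]mulmxA mulVmx// mul1mx subrr.
Unshelve. all: end_near. Qed.

(** One connection W serves all x, as partial fractions in x require. *)
Lemma laxA_derive :
  thoo_1 th != thoo_2 th -> thoo_1 th != thoo_3 th -> thoo_2 th != thoo_3 th ->
  exists w1 w2 w3, let W := mx9 0 0 0 w1 (du / u t) 0 w2 w3 (dv / v t) in
  curv_infty th t (q1 t) (p1 t) (q2 t) (p2 t) dq1 dp1 dq2 dp2 W = 0 /\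
  forall x, mx_is_derive
    (fun s => laxA th s (q1 s) (p1 s) (q2 s) (p2 s) (u s) (v s) x) t
    (invmx G *m
      ((x ^+ 2)^-1 *: dhatAm1 (q1 t) (q2 t) dq1 dq2
       + x^-1 *: dhatA0 th t (q1 t) (p1 t) (q2 t) (p2 t) dq1 dp1 dq2 dp2
       + (x - 1)^-1 *: dhatA1 th (q1 t) (p1 t) (q2 t) (p2 t) dq1 dp1 dq2 dp2
       + comm3 ((x ^+ 2)^-1 *: hatAm1 t (q1 t) (q2 t)
                + x^-1 *: hatA0 th t (q1 t) (p1 t) (q2 t) (p2 t)
                + (x - 1)^-1 *: hatA1 th (q1 t) (p1 t) (q2 t) (p2 t)) W) *m G).
Proof.
move=> th12 th13 th23.
have [x1 [x2 [x3 Gd]]] := gaugeG_derive.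
have [w1 [w2 [w3 WE]]] := gauge_connection x1 x2 x3.
exists w1, w2, w3 => W; split.
  exact: hatA_infty_derive Gd (esym WE).
have Gu : G \in unitmx by exact: gaugeG_unit.
move=> x; rewrite /W -WE /comm3.
apply: (mx_is_derive_conj Gd Gu).
apply: mx_is_deriveD; last exact: mx_is_deriveZr hatA1_derive.
apply: mx_is_deriveD; first exact: mx_is_deriveZr hatAm1_derive.
exact: mx_is_deriveZr hatA0_derive.
Qed.

End LaxDerivative.

(** * Partial fractions of the curvature *)

Section Curvature.
Context {K : numFieldType} (th : exponents K).

Lemma laxB_derive (t q p q' p' u v x : K) : t != 0 -> x != 0 -> mx_is_derive
  (laxB th t q p q' p' u v) x
  ((t * x ^+ 2)^-1 *: (invmx (gaugeG th t q p q' p' u v)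
     *m hatAm1 t q q' *m gaugeG th t q p q' p' u v)).
Proof.
move=> t0 x0; apply: (@mx_is_deriveZ _ _ _ (fun y => - (t * y)^-1)).
notypeclasses refine (is_derive_eq _ _); [is_derive_rules|cbv beta; field].
all: by rewrite ?mulf_neq0 ?t0 ?x0.
Qed.

Lemma comm3D (M N P : 'M[K]_3) : comm3 (M + N) P = comm3 M P + comm3 N P.
Proof. by rewrite /comm3 mulmxDl mulmxDr opprD addrACA. Qed.

Lemma comm3Zl k (M N : 'M[K]_3) : comm3 (k *: M) N = k *: comm3 M N.
Proof. by rewrite /comm3 -scalemxAl -scalemxAr scalerBr. Qed.

Lemma comm3Zr k (M N : 'M[K]_3) : comm3 M (k *: N) = k *: comm3 M N.
Proof. by rewrite /comm3 -scalemxAl -scalemxAr scalerBr. Qed.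

Lemma curvature_conj (k l : K) (G dA A N : 'M[K]_3) : G \in unitmx ->
  invmx G *m dA *m G - k *: (invmx G *m N *m G)
  + comm3 (invmx G *m A *m G) (l *: (invmx G *m N *m G)) =
  invmx G *m (dA - k *: N + comm3 A (l *: N)) *m G.
Proof.
move=> Gu; rewrite mulmxDr mulmxDl mulmxBr mulmxBl !comm3Zr.
rewrite -!scalemxAr -!scalemxAl; congr (_ + _ *: _).
by rewrite /comm3 mulmxBr mulmxBl !mulmxA !mulmxK.
Qed.

(** Partial fractions in x: the commutator of hatA1 with hatAm1 comes with
1 / (x (x - 1)) = 1 / (x - 1) - 1 / x, hence contributes to two poles. *)
Lemma curvature_poles (t q1 p1 q2 p2 dq1 dp1 dq2 dp2 x : K) (W : 'M[K]_3)
    (A := (x ^+ 2)^-1 *: hatAm1 t q1 q2 + x^-1 *: hatA0 th t q1 p1 q2 p2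
          + (x - 1)^-1 *: hatA1 th q1 p1 q2 p2) :
  t != 0 -> x != 0 -> x != 1 ->
  (x ^+ 2)^-1 *: dhatAm1 q1 q2 dq1 dq2
  + x^-1 *: dhatA0 th t q1 p1 q2 p2 dq1 dp1 dq2 dp2
  + (x - 1)^-1 *: dhatA1 th q1 p1 q2 p2 dq1 dp1 dq2 dp2
  + comm3 A W - (t * x ^+ 2)^-1 *: hatAm1 t q1 q2
  + comm3 A (- (t * x)^-1 *: hatAm1 t q1 q2) =
  (x ^+ 2)^-1 *: curv_double th t q1 p1 q2 p2 dq1 dq2 W
  + x^-1 *: (curv_infty th t q1 p1 q2 p2 dq1 dp1 dq2 dp2 W
             - curv_simple th t q1 p1 q2 p2 dq1 dp1 dq2 dp2 W)
  + (x - 1)^-1 *: curv_simple th t q1 p1 q2 p2 dq1 dp1 dq2 dp2 W.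
Proof.
rewrite -[x == 1]subr_eq0 => t0 x0 x1.
rewrite /A /curv_double /curv_infty /curv_simple !(comm3D, comm3Zl, comm3Zr).
rewrite [comm3 (hatAm1 _ _ _) (hatAm1 _ _ _)]subrr.
move: (comm3 _ _) (comm3 _ _) (comm3 _ _) (comm3 _ _) (comm3 _ _) => c1 c2 c3 c4 c5.
move: (dhatA0 _ _ _ _ _ _ _ _ _ _) (dhatA1 _ _ _ _ _ _ _ _ _) => d0 d1.
move: (dhatAm1 _ _ _ _) (hatAm1 _ _ _) => dm m.
apply/matrixP => i j; rewrite !mxE; field.
by rewrite t0 x0 x1.
Qed.

(** The functions x^-2 and (x - 1)^-1 - x^-1 are already independent on the two
points 2 and -1. *)
Lemma two_poles_eq0 (P Q : 'M[K]_3) :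
  (forall x : K, x != 0 -> x != 1 ->
     (x ^+ 2)^-1 *: P - x^-1 *: Q + (x - 1)^-1 *: Q = 0) <-> P = 0 /\ Q = 0.
Proof.
split=> [PQ0|[-> ->] x _ _]; last by rewrite !scaler0 subrr addr0.
have two0 : 2 != 0 :> K by rewrite pnatr_eq0.
have /matrixP A : (2 ^+ 2)^-1 *: P - 2^-1 *: Q + (2 - 1)^-1 *: Q = 0.
  by apply: PQ0; rewrite ?pnatr_eq0 // -subr_eq0 (_ : 2 - 1 = 1) ?oner_eq0; last ring.
have /matrixP B : ((-1) ^+ 2)^-1 *: P - (-1)^-1 *: Q + (-1 - 1)^-1 *: Q = 0.
  apply: PQ0; rewrite ?oppr_eq0 ?oner_eq0// -subr_eq0.
  by rewrite (_ : -1 - 1 = - 2) ?oppr_eq0; last ring.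
have three0 : 3 != 0 :> K by rewrite pnatr_eq0.
split; apply/matrixP => i j; move: (A i j) (B i j); rewrite !mxE => Aij Bij.
- apply: (eq_by_lin0 (lin0 (- (4 / 3)) Aij (lin0 (4 / 3) Bij (erefl 0)))).
  by field; rewrite ?two0 ?three0.
- apply: (eq_by_lin0 (lin0 (8 / 3) Aij (lin0 (- (2 / 3)) Bij (erefl 0)))).
  by field; rewrite ?two0 ?three0.
Qed.

End Curvature.

(** * The Hamiltonian vector field *)

Section HamiltonianVectorField.
Context {K : numFieldType} (th : exponents K) (t q1 p1 q2 p2 : K).
Hypothesis t0 : t != 0.

Lemma is_derive_Ham_p1 :
  is_derive p1 1 (fun y => Ham th t q1 y q2 p2) (tflow_q1 th t q1 p1 q2 p2 / t).
Proof.
rewrite /Ham /tHam /tHV /tflow_q1.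
by notypeclasses refine (is_derive_eq _ _); [is_derive_rules|cbv beta; field].
Qed.

Lemma is_derive_Ham_q1 :
  is_derive q1 1 (fun y => Ham th t y p1 q2 p2) (- (tflow_p1 th t q1 p1 q2 p2 / t)).
Proof.
rewrite /Ham /tHam /tHV /tflow_p1.
by notypeclasses refine (is_derive_eq _ _); [is_derive_rules|cbv beta; field].
Qed.

Lemma is_derive_Ham_p2 :
  is_derive p2 1 (fun y => Ham th t q1 p1 q2 y) (tflow_q2 th t q1 p1 q2 p2 / t).
Proof.
rewrite /Ham /tHam /tHV /tflow_q2.
by notypeclasses refine (is_derive_eq _ _); [is_derive_rules|cbv beta; field].
Qed.

Lemma is_derive_Ham_q2 :
  is_derive q2 1 (fun y => Ham th t q1 p1 y p2) (- (tflow_p2 th t q1 p1 q2 p2 / t)).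
Proof.
rewrite /Ham /tHam /tHV /tflow_p2.
by notypeclasses refine (is_derive_eq _ _); [is_derive_rules|cbv beta; field].
Qed.

End HamiltonianVectorField.

(** * Compatibility and the Hamiltonian system *)

Section Compatibility.
Context {R : realType}.
Local Notation C := (Cplx R).

Lemma mx_derivE (M : C -> 'M[C]_3) t dM : mx_is_derive M t dM ->
  mx_deriv M t = dM.
Proof. by move=> Md; apply/matrixP => i j; rewrite mxE (is_derive1E (Md i j)). Qed.

Context (th : exponents C) (q1 p1 q2 p2 u v : C -> C) (t : C).
Hypotheses (q1d : derivable q1 t 1) (p1d : derivable p1 t 1).
Hypotheses (q2d : derivable q2 t 1) (p2d : derivable p2 t 1).
Hypotheses (ud : derivable u t 1) (vd : derivable v t 1).
Hypotheses (t0 : t != 0) (q10 : q1 t != 0) (q20 : q2 t != 0).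
Hypotheses (u0 : u t != 0) (v0 : v t != 0).
Hypothesis th0 : th0_1 th != 0.
Hypotheses (th12 : thoo_1 th != thoo_2 th) (th13 : thoo_1 th != thoo_3 th).
Hypothesis th23 : thoo_2 th != thoo_3 th.

(** Derivatives occur at the single point t only, so that compatibility and
the differential equations are equivalent pointwise. *)
Lemma compatible_atP :
  let A s x := laxA th s (q1 s) (p1 s) (q2 s) (p2 s) (u s) (v s) x in
  let B s x := laxB th s (q1 s) (p1 s) (q2 s) (p2 s) (u s) (v s) x in
  (forall x, x != 0 -> x != 1 ->
     mx_deriv (A ^~ x) t - mx_deriv (B t) x
     + (A t x *m B t x - B t x *m A t x) = 0) <->
  [/\ t * q1^`()%classic t = tflow_q1 th t (q1 t) (p1 t) (q2 t) (p2 t),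
      t * p1^`()%classic t = tflow_p1 th t (q1 t) (p1 t) (q2 t) (p2 t),
      t * q2^`()%classic t = tflow_q2 th t (q1 t) (p1 t) (q2 t) (p2 t)
    & t * p2^`()%classic t = tflow_p2 th t (q1 t) (p1 t) (q2 t) (p2 t)] /\
  (t * q1 t * (u^`()%classic t / u t)
     = tflow_u th t (q1 t) (p1 t) (q2 t) (p2 t) /\
   t * q2 t * (v^`()%classic t / v t)
     = tflow_v th t (q1 t) (p1 t) (q2 t) (p2 t)).
Proof.
move=> A B.
have [w1 [w2 [w3]]] := laxA_derive (is_derive1P q1d) (is_derive1P p1d)
  (is_derive1P q2d) (is_derive1P p2d) (is_derive1P ud) (is_derive1P vd)
  q10 q20 u0 v0 th12 th13 th23.
set W := mx3 _ => -[S0 Ad].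
rewrite -(curv_flowP t0 q10 q20 th0 th12 th13 th23 S0) -two_poles_eq0.
set G := gaugeG th t (q1 t) (p1 t) (q2 t) (p2 t) (u t) (v t) in Ad.
have Gu : G \in unitmx by exact: gaugeG_unit.
have conj0 (M : 'M[C]_3) : invmx G *m M *m G = 0 <-> M = 0.
  split=> [M0|->]; last by rewrite mulmx0 mul0mx.
  by rewrite -[M](mulKVmx Gu) -[_ *m M](mulmxK Gu) M0 mul0mx mulmx0.
have curvE x : x != 0 -> x != 1 ->
    mx_deriv (A ^~ x) t - mx_deriv (B t) x
      + (A t x *m B t x - B t x *m A t x) =
    invmx G *m ((x ^+ 2)^-1 *: curv_double th t (q1 t) (p1 t) (q2 t) (p2 t)
                  (q1^`()%classic t) (q2^`()%classic t) W
                - x^-1 *: curv_simple th t (q1 t) (p1 t) (q2 t) (p2 t)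
                  (q1^`()%classic t) (p1^`()%classic t)
                  (q2^`()%classic t) (p2^`()%classic t) W
                + (x - 1)^-1 *: curv_simple th t (q1 t) (p1 t) (q2 t) (p2 t)
                  (q1^`()%classic t) (p1^`()%classic t)
                  (q2^`()%classic t) (p2^`()%classic t) W) *m G.
  move=> x0 x1; rewrite (mx_derivE (Ad x)).
  rewrite (mx_derivE (laxB_derive _ _ _ _ _ _ _ t0 x0)).
  apply: etrans (curvature_conj _ _ _ _ _ Gu) _.
  by rewrite (curvature_poles _ _ _ _ _ _ _ _ _ _ t0 x0 x1) S0 sub0r scalerN.
split=> compat x x0 x1; last by rewrite curvE// conj0 compat.
by have := compat x x0 x1; rewrite curvE// => /conj0.
Qed.

End Compatibility.

Theorem mainTheorem9 (R : realType) (th : exponents (Cplx R))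
    (D : set (Cplx R)) (q1 p1 q2 p2 u v : Cplx R -> Cplx R) :
  th0_1 th + th0_2 th + th1 th + thoo_1 th + thoo_2 th + thoo_3 th = 0 ->
  th0_1 th != 0 ->
  th1 th != 0 ->
  thoo_1 th != thoo_2 th ->
  thoo_1 th != thoo_3 th ->
  thoo_2 th != thoo_3 th ->
  is_domain D ->
  ~ D 0 ->
  holomorphic_on D q1 -> holomorphic_on D p1 ->
  holomorphic_on D q2 -> holomorphic_on D p2 ->
  holomorphic_on D u -> holomorphic_on D v ->
  (forall t, D t -> [/\ q1 t != 0, q2 t != 0, u t != 0 & v t != 0]) ->
  compatible D
    (fun t x => laxA th t (q1 t) (p1 t) (q2 t) (p2 t) (u t) (v t) x)
    (fun t x => laxB th t (q1 t) (p1 t) (q2 t) (p2 t) (u t) (v t) x)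
  <->
  [/\ hamiltonian_system (Ham th) D q1 p1 q2 p2,
      (forall t, D t ->
         t * q1 t / u t * u^`()%classic t
         = q2 t * (p2 t * q2 t - p2 t - thoo_3 th)
           - q1 t * (2 * p1 t + p2 t + t) - th1 th) &
      (forall t, D t ->
         t * q2 t / v t * v^`()%classic t
         = - p1 t * (q1 t + q2 t) - (2 * p2 t + t) * q2 t - th1 th)].
Proof.
move=> _ th0 _ th12 th13 th23 _ D0 q1h p1h q2h p2h uh vh nz.
have neq0 t : D t -> t != 0 by move=> Dt; apply/eqP => t0; apply: D0; rewrite -t0.
have atP t (Dt : D t) :
  (forall x, x != 0 -> x != 1 -> _) <-> _ :=
  let: And4 q10 q20 u0 v0 := nz t Dt in
  compatible_atP (q1h t Dt) (p1h t Dt) (q2h t Dt) (p2h t Dt) (uh t Dt) (vh t Dt)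
    (neq0 t Dt) q10 q20 u0 v0 th0 th12 th13 th23.
have mulE (a b c : Cplx R) : a / b * c = a * (c / b) by rewrite mulrAC mulrA.
split=> [compat|[ham hu hv] t x Dt].
  have odes t Dt := (atP t Dt).1 (fun x => compat t x Dt).
  split=> t Dt; have t0 := neq0 t Dt; have [[E1 E2 E3 E4] [E5 E6]] := odes t Dt.
  - rewrite (is_derive1E (is_derive_Ham_p1 _ _ _ _ _ t0)).
    rewrite (is_derive1E (is_derive_Ham_q1 _ _ _ _ _ t0)).
    rewrite (is_derive1E (is_derive_Ham_p2 _ _ _ _ _ t0)).
    rewrite (is_derive1E (is_derive_Ham_q2 _ _ _ _ _ t0)).
    rewrite !opprK -E1 -E2 -E3 -E4.
    by split; field.
  - by rewrite mulE E5.
  - by rewrite mulE E6.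
move: x; apply/(atP t Dt); have t0 := neq0 t Dt.
rewrite -!mulE (hu t Dt) (hv t Dt).
have := ham t Dt.
rewrite (is_derive1E (is_derive_Ham_p1 _ _ _ _ _ t0)).
rewrite (is_derive1E (is_derive_Ham_q1 _ _ _ _ _ t0)).
rewrite (is_derive1E (is_derive_Ham_p2 _ _ _ _ _ t0)).
rewrite (is_derive1E (is_derive_Ham_q2 _ _ _ _ _ t0)).
by rewrite !opprK => -[-> -> -> ->]; split=> //; split; field.
Qed.
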